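(* (1) Let $f(n)$ denote the number of ways to write $n\ge0$ as $\sum_{k\ge0}\epsilon_k2^k$ with all $\epsilon_k\in\{0,1,2\}$. Let $d\ge2$ be an integer. If the sequence $(f(n)\bmod d)_{n\ge0}$ is eventually periodic with period $T$, then $(d,T)=(2,3)$. (2) Let $b\ge3$ and $d\ge2$ be integers, and let $g(n)$ denote the number of ways to write $n\ge0$ as $\sum_{k\ge0}\epsilon_kb^k$ with all $\epsilon_k\in\{0,1\}$. Then the sequence $(g(n)\bmod d)_{n\ge0}$ is not eventually periodic.
   Context: Representations are counted as sequences $(\epsilon_k)_{k\ge0}$ with finitely many nonzero terms. A sequence $(u_n)$ is eventually periodic if there exist integers $N\ge0$, $T\ge1$ with $u_{n+T}=u_n$ for all $n\ge N$; its period is the smallest such $T$. *)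

(* Defs.v *)
From mathcomp Require Import all_boot finmap.
From mathcomp Require Import boolp classical_sets functions cardinality.

Set Implicit Arguments.
Unset Strict Implicit.
Unset Printing Implicit Defensive.

Local Open Scope classical_set_scope.
Local Open Scope nat_scope.

(* A finitely supported function [eps] stands for a digit sequence
   $(\epsilon_k)_{k\ge0}$ with finitely many nonzero terms, so that summing over
   its support is the same as summing over all $k$. *)
Definition reprs (b : nat) (D : seq nat) (n : nat)
    : set {fsfun nat -> nat with 0} :=
  [set eps : {fsfun nat -> nat with 0} | (forall k, eps k \in D) /\
             n = \sum_(k <- finsupp eps) eps k * b ^ k].

(* [fset_set] sends infinite sets to the empty set; [reprs_finite] shows that
   this never happens for a base at least 2. *)
Definition nb_reprs (b : nat) (D : seq nat) (n : nat) : nat :=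
  #|` fset_set (reprs b D n) |.

Definition eventual_shift (u : nat -> nat) (T : nat) : Prop :=
  exists N : nat, forall n, N <= n -> u (n + T) = u n.

Definition eventually_periodic (u : nat -> nat) : Prop :=
  exists2 T : nat, 1 <= T & eventual_shift u T.

Definition eventually_periodic_with_period (u : nat -> nat) (T : nat) : Prop :=
  [/\ 1 <= T, eventual_shift u T &
      forall T', 1 <= T' -> eventual_shift u T' -> T <= T'].

Lemma reprs_finite (b : nat) (D : seq nat) (n : nat) :
  2 <= b -> finite_set (reprs b D n).
Proof.
move=> b_ge2.
pose F (eps : {fsfun nat -> nat with 0}) : {ffun 'I_n.+1 -> 'I_n.+1} :=
  [ffun k : 'I_n.+1 => inord (eps k)].
have term_le eps k : reprs b D n eps -> eps k * b ^ k <= n.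
  case=> _ ->; case: (boolP (k \in finsupp eps)) => [ks|kNs].
    by rewrite (big_fsetD1 k) //= leq_addr.
  by rewrite fsfun_dflt.
have pow_gt0 k : 0 < b ^ k by rewrite expn_gt0 (leq_trans _ b_ge2).
have digit_le eps k : reprs b D n eps -> eps k <= n.
  by move=> /term_le - /(_ k); apply: leq_trans; rewrite leq_pmulr.
have digit0 eps k : reprs b D n eps -> n < k -> eps k = 0.
  move=> /term_le - /(_ k) le_n lt_nk; apply/eqP; rewrite -leqn0 leqNgt.
  apply/negP => e_gt0; have := leq_trans (leq_pmull (b ^ k) e_gt0) le_n.
  by rewrite leqNgt (ltn_trans lt_nk) // ltn_expl.
have F_inj : {in reprs b D n &, injective F}.
  move=> e1 e2 /set_mem r1 /set_mem r2 /ffunP eF; apply/fsfunP => k.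
  have [lt_nk|le_kn] := ltnP n k; first by rewrite !digit0.
  have := congr1 val (eF (Ordinal (le_kn : k < n.+1))).
  by rewrite !ffunE /= !inordK // ltnS digit_le.
have : finite_set (F @` reprs b D n) by exact: finite_finset.
by rewrite (eq_finite_set (inj_card_eq F_inj)).
Qed.

(* Main.v *)
(** Write f(n) and g(n) for the two counting functions. Splitting off the digit
    at k = 0 gives f(2n+1) = f(n), f(2n+2) = f(n) + f(n+1), and g(bn) = g(bn+1) = g(n),
    g(bn+r) = 0 for 2 <= r < b.

    (1) If T = 2T' is an eventual period of f mod d, then so is T', since
    f(2n+1) = f(n); hence the least period T = 2k+1 is odd. Comparing f(n+T) and f(n)
    for n even and n odd gives f(n+k) = -f(n+1) and f(n+k+1) = f(n) + f(n+1) modulo d,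
    whence f(n) + f(n+1) + f(n+2) = 0 for all large n; so 3 is an eventual period, and
    for n = 2m+1 this relation reads 2(f(m) + f(m+1)) = 0, so that 2f(n) = 0 for large
    n. As f(2^j - 1) = 1, this forces d = 2. Finally T = 1 would make f eventually even.

    (2) g vanishes on the interval from 2b^j to 3b^j - 1, whose length is unbounded,
    while g(b^j) = 1, so g mod d cannot be eventually periodic. *)

Require Import Defs.
From mathcomp Require Import all_boot all_algebra finmap zify ring.
From mathcomp Require Import classical_sets cardinality.

Set Implicit Arguments.
Unset Strict Implicit.
Unset Printing Implicit Defensive.

Local Open Scope nat_scope.

(** * Prepending and removing the lowest digit *)

Notation digits := {fsfun nat -> nat with 0}.

Definition dvalue (b : nat) (eps : digits) : nat :=
  \sum_(k <- finsupp eps) eps k * b ^ k.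

(** The set after [in] need only contain the support: 0 is listed even if [a] is 0. *)
Definition dcons (a : nat) (eps : digits) : digits :=
  [fsfun k in (0 |` [fset i.+1 | i in finsupp eps])%fset => if k is i.+1 then eps i else a].

Definition dtail (eps : digits) : digits :=
  [fsfun k in [fset i.-1 | i in finsupp eps]%fset => eps k.+1].

Lemma dconsE a (eps : digits) k : dcons a eps k = if k is i.+1 then eps i else a.
Proof.
rewrite fsfunE; case: ifPn => //; case: k => [|i]; first by rewrite !inE eqxx.
rewrite !inE /= => iNs; rewrite fsfun_dflt //; apply: contra iNs => i_s.
by apply/imfsetP; exists i.
Qed.

Lemma dtailE (eps : digits) k : dtail eps k = eps k.+1.
Proof.
rewrite fsfunE; case: ifPn => // kNs; rewrite fsfun_dflt //.
by apply: contra kNs => k_s; apply/imfsetP; exists k.+1.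
Qed.

Lemma dcons_tail (eps : digits) : dcons (eps 0) (dtail eps) = eps.
Proof. by apply/fsfunP => -[|k]; rewrite dconsE ?dtailE. Qed.

Lemma dcons_inj a : injective (dcons a).
Proof.
move=> e e' /fsfunP eq_ee'; apply/fsfunP => k.
by have := eq_ee' k.+1; rewrite !dconsE.
Qed.

(** Terms off the support vanish; a sum over an initial segment can be reindexed when digits are
    shifted. *)
Lemma dvalue_ord b (eps : digits) M : (forall k, k \in finsupp eps -> k < M) ->
  dvalue b eps = \sum_(k < M) eps k * b ^ k.
Proof.
move=> ltM; rewrite -(big_mkord xpredT (fun k => eps k * b ^ k)).
rewrite (bigID (mem (finsupp eps))) /= [X in _ + X]big1 ?addn0.
  rewrite -big_filter; apply: perm_big; apply: uniq_perm => //.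
    by rewrite filter_uniq ?iota_uniq.
  move=> k; rewrite mem_filter mem_index_iota /=.
  by case: (boolP (k \in finsupp eps)) => // /ltM ->.
by move=> k kNs; rewrite fsfun_dflt.
Qed.

Lemma dvalue_cons b a (eps : digits) : dvalue b (dcons a eps) = a + b * dvalue b eps.
Proof.
pose M := (\max_(k <- finsupp eps) k).+1.
have ltM k : k \in finsupp eps -> k < M.
  by move=> ks; rewrite ltnS; apply: (@leq_bigmax_seq _ _ xpredT id).
rewrite (@dvalue_ord _ _ M.+1) => [|[|k]]; last 1 first.
- by rewrite mem_finsupp dconsE -mem_finsupp => /ltM.
- rewrite big_ord_recl dconsE muln1 (dvalue_ord b ltM) big_distrr /=.
  by congr (_ + _); apply: eq_bigr => k _; rewrite dconsE expnS mulnCA.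
by [].
Qed.

(** * Recurrence for the number of representations *)

Lemma reprs_cons b D n a (eps : digits) :
  reprs b D n (dcons a eps) <->
  [/\ a \in D, (forall k, eps k \in D) & n = a + b * dvalue b eps].
Proof.
split=> [[inD ->]|[aD inD ->]].
  split; first by have := inD 0; rewrite dconsE.
    by move=> k; have := inD k.+1; rewrite dconsE.
  by rewrite -dvalue_cons.
split; last by rewrite -dvalue_cons.
by case=> [|k]; rewrite dconsE.
Qed.

(** The sum counts the representations with lowest digit [a]; deleting this digit is a bijection
    onto the representations of (n - a) / b. *)
Lemma card_reprs_digit0 b D n a : 2 <= b -> a \in D ->
  \sum_(eps <- fset_set (reprs b D n)) ((eps : digits) 0 == a) =
  if (a <= n) && (b %| n - a) then nb_reprs b D ((n - a) %/ b) else 0.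
Proof.
move=> b_ge2 aD; have b_gt0 : 0 < b by lia.
have memR m (eps : digits) : (eps \in fset_set (reprs b D m)) = (eps \in reprs b D m).
  by rewrite in_fset_set //; apply: reprs_finite.
case: ifPn => [/andP[le_an /dvdnP[m def_m]]|no].
  rewrite def_m mulnK // /nb_reprs.
  transitivity #|` [fset dcons a e | e in fset_set (reprs b D m)]%fset|; last first.
    by rewrite card_imfset //; apply: dcons_inj.
  rewrite -(big_mkcond (fun e : digits => e 0 == a) (fun=> 1)) big_fset_condE.
  rewrite -card_fset_sum1 /=; congr #|` _|.
  apply/fsetP => eps; rewrite !inE memR; apply/andP/imfsetP => [[/set_mem eR /eqP e0]|[e' /=]].
    exists (dtail eps); last by rewrite -e0 dcons_tail.
    move: eR; rewrite -{1}(dcons_tail eps) => /reprs_cons[_ inD def_n].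
    rewrite memR; apply/mem_set; split=> //.
    by apply/eqP; rewrite -(eqn_pmul2l b_gt0) mulnC -def_m def_n e0 addKn.
  rewrite memR => /set_mem[inD def_e'] ->; rewrite dconsE; split=> //.
  apply/mem_set/reprs_cons; split=> //.
  by rewrite /dvalue -def_e' mulnC -def_m subnKC.
rewrite big_seq big1 // => eps; rewrite memR => /set_mem.
rewrite -(dcons_tail eps) dconsE => /reprs_cons[_ _ def_n].
case: eqP => // def_a; case/negP: no.
by rewrite def_n def_a leq_addr addKn dvdn_mulr.
Qed.

Lemma nb_reprs_rec b D n : 2 <= b -> uniq D ->
  nb_reprs b D n =
  \sum_(a <- D | (a <= n) && (b %| n - a)) nb_reprs b D ((n - a) %/ b).
Proof.
move=> b_ge2 uD; rewrite [RHS]big_mkcond big_seq.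
under eq_bigr => a aD do rewrite -card_reprs_digit0 //.
(* After the exchange, each [eps] contributes once, at [a = eps 0], since [D] has no repetition. *)
rewrite -big_seq exchange_big /= /nb_reprs card_fset_sum1.
rewrite big_seq [RHS]big_seq; apply: eq_bigr => eps.
rewrite in_fset_set; last exact: reprs_finite.
move=> /set_mem[inD _].
by rewrite -(big_mkcond (fun a => eps 0 == a)) sum1_count
  -(eq_count (fun a => eq_sym _ _)) count_uniq_mem ?inD.
Qed.

Lemma nb_reprs0 b D : 2 <= b -> 0 \in D -> nb_reprs b D 0 = 1.
Proof.
move=> b_ge2 D0; rewrite /nb_reprs.
suff -> : fset_set (reprs b D 0) = [fset [fsfun]]%fset by rewrite cardfs1.
apply/fsetP => eps; rewrite in_fset_set; last exact: reprs_finite.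
rewrite inE; apply/idP/eqP => [/set_mem[_ /esym/eqP]|->].
  rewrite sum_nat_seq_eq0 => /allP e0; apply/fsfunP => k; rewrite fsfunE.
  apply/eqP; case: (boolP (k \in finsupp eps)) => [/e0|/fsfun_dflt->//] /=.
  by rewrite muln_eq0 expn_eq0 => /orP[//|]; lia.
by apply/mem_set; split=> [k|]; rewrite ?fsfunE // finsupp0 big_seq_fset0.
Qed.

(** * Base 2 with digits 0, 1, 2 *)

Lemma nb_reprs012_odd n : nb_reprs 2 [:: 0; 1; 2] n.*2.+1 = nb_reprs 2 [:: 0; 1; 2] n.
Proof.
rewrite nb_reprs_rec // !big_cons big_nil.
have -> : (0 <= n.*2.+1) && (2 %| n.*2.+1 - 0) = false by lia.
have -> : (1 <= n.*2.+1) && (2 %| n.*2.+1 - 1) = true by lia.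
have -> : (2 <= n.*2.+1) && (2 %| n.*2.+1 - 2) = false by lia.
by rewrite addn0; congr nb_reprs; lia.
Qed.

Lemma nb_reprs012_even n : nb_reprs 2 [:: 0; 1; 2] n.*2.+2 =
  nb_reprs 2 [:: 0; 1; 2] n + nb_reprs 2 [:: 0; 1; 2] n.+1.
Proof.
rewrite nb_reprs_rec // !big_cons big_nil.
have -> : (0 <= n.*2.+2) && (2 %| n.*2.+2 - 0) = true by lia.
have -> : (1 <= n.*2.+2) && (2 %| n.*2.+2 - 1) = false by lia.
have -> : (2 <= n.*2.+2) && (2 %| n.*2.+2 - 2) = true by lia.
by rewrite addn0 addnC; congr (nb_reprs _ _ _ + nb_reprs _ _ _); lia.
Qed.

Section SternRing.
Import GRing.Theory.
Local Open Scope ring_scope.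

(** Used with [R] equal to ['Z_d] and [u] the residues of f, so that congruences can be
    subtracted. *)
Variables (R : comNzRingType) (u : nat -> R).
Hypothesis u0 : u 0 = 1.
Hypothesis u_odd : forall n, u n.*2.+1 = u n.
Hypothesis u_even : forall n, u n.*2.+2 = u n + u n.+1.

Lemma stern_one M : exists2 n, (M <= n)%N & u n = 1.
Proof.
elim: M => [|M [n le_Mn un]]; first by exists 0.
by exists n.*2.+1; [lia | rewrite u_odd].
Qed.

Lemma stern_shift_half T N : (forall n, (N <= n)%N -> u (n + T.*2)%N = u n) ->
  forall n, (N <= n)%N -> u (n + T)%N = u n.
Proof.
move=> shiftT n le_Nn; rewrite -u_odd -[RHS]u_odd -(shiftT n.*2.+1); last lia.
by congr u; lia.
Qed.

Lemma stern_sum3 k N : (forall n, (N <= n)%N -> u (n + k.*2.+1)%N = u n) ->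
  forall n, (N <= n)%N -> u n + u n.+1 + u n.+2 = 0.
Proof.
move=> shiftT.
(* The odd shift swaps parities: 2n+1 goes to 2(n+k)+2, and in [B] 2n+2 goes to 2(n+k+1)+1. *)
have A n : (N <= n)%N -> u (n + k)%N + u (n + k).+1 = u n.
  move=> le_Nn; rewrite -u_even -[RHS]u_odd -(shiftT n.*2.+1); last lia.
  by congr u; lia.
have B n : (N <= n)%N -> u (n + k).+1 = u n + u n.+1.
  move=> le_Nn; rewrite -u_even -u_odd -(shiftT n.*2.+2); last lia.
  by congr u; lia.
(* Substitute [B] at n and n+1 into [A] at n+1, then cancel u(n+1). *)
move=> n le_Nn; have := A n.+1 (leqW le_Nn).
rewrite (B n.+1) ?leqW // addSn B // => e.
by apply: (addrI (u n.+1)); rewrite addr0 -[RHS]e; ring.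
Qed.

Lemma stern_sum3_double N : (forall n, (N <= n)%N -> u n + u n.+1 + u n.+2 = 0) ->
  2 = 0 :> R.
Proof.
(* The index where [u] is 1 is written n+2, so that [sum3] at n ends in 1. *)
move=> sum3; have [[|[|n]] le_n un] := stern_one N.+2 => //.
have le_Nn : (N <= n)%N by lia.
have := sum3 n.*2.+1; rewrite -doubleS u_odd u_even u_odd => /(_ _) s1.
have := sum3 n; rewrite un => /(_ _) s0.
(* Twice the relation at n minus the one at 2n+1 leaves 2. *)
transitivity (2 * (u n + u n.+1 + 1) - (u n + (u n + u n.+1) + u n.+1)); first by ring.
by rewrite s0 ?s1; [ring | lia | lia].
Qed.

End SternRing.

Lemma nat_mod_Zp d m n : 1 < d -> m = n %[mod d] <-> (m%:R = n%:R :> 'Z_d)%R.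
Proof.
move=> d_gt1; split=> [eq_mn|/(congr1 (@nat_of_ord _))]; last by rewrite !val_Zp_nat.
by apply: val_inj; rewrite /= !val_Zp_nat.
Qed.

Lemma period_nb_reprs012 d T : 2 <= d ->
  eventually_periodic_with_period (fun n => nb_reprs 2 [:: 0; 1; 2] n %% d) T ->
  (d, T) = (2, 3).
Proof.
move=> d_ge2 [T_gt0 [N shiftT] minT].
pose u n : 'Z_d := ((nb_reprs 2 [:: 0; 1; 2] n)%:R)%R.
have u0 : u 0 = 1%R by rewrite /u nb_reprs0.
have u_odd n : u n.*2.+1 = u n by rewrite /u nb_reprs012_odd.
have u_even n : u n.*2.+2 = (u n + u n.+1)%R by rewrite /u nb_reprs012_even GRing.natrD.
have uT n : N <= n -> u (n + T) = u n by move=> /shiftT/(nat_mod_Zp _ _ d_ge2).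
have shiftP T' N' : (forall n, N' <= n -> u (n + T') = u n) -> 0 < T' -> T <= T'.
  by move=> uT' /minT; apply; exists N' => n /uT'/(nat_mod_Zp _ _ d_ge2).
have [k def_T] : exists k, T = k.*2.+1.
  exists T./2; case: (boolP (odd T)) => [oddT|/even_halfK def_T].
    by rewrite -{1}(odd_double_half T) oddT.
  (* An even [T] could be halved, against minimality. *)
  suff /shiftP le_T: forall n, N <= n -> u (n + T./2) = u n.
    by exfalso; have := le_T ltac:(lia); lia.
  by apply: stern_shift_half => // n /uT; rewrite def_T.
have sum3 n : N <= n -> (u n + u n.+1 + u n.+2 = 0)%R.
  by apply: (stern_sum3 u_odd u_even (k := k)); rewrite -def_T.
have two0 := stern_sum3_double u0 u_odd u_even sum3.
have def_d : d = 2.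
  have : 2 = 0 %[mod d] by apply/nat_mod_Zp.
  by rewrite mod0n => /eqP/dvdn_leq; lia.
have le_T3 : T <= 3.
  apply: (shiftP 3 N) => // n le_Nn.
  (* Compare [sum3] at n and n+1. *)
  apply: (GRing.addrI (u n.+1 + u n.+2)%R); rewrite !addnS addn0 sum3 ?leqW //.
  by rewrite -(sum3 n le_Nn) [RHS]GRing.addrC GRing.addrA.
have T_neq1 : T <> 1.
  (* Three consecutive values 1 give 3 = 0, which with 2 = 0 yields 1 = 0. *)
  move=> T1; have [n le_Nn un] := stern_one u0 u_odd N.
  have un1 : u n.+1 = 1%R by rewrite -un -(uT n) // T1 addn1.
  have un2 : u n.+2 = 1%R by rewrite -un1 -(uT n.+1) ?leqW // T1 addn1.
  have := sum3 n le_Nn; rewrite un un1 un2 => three0.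
  move: three0; rewrite -[(1 + 1)%R]/(2%:R : 'Z_d)%R two0 GRing.add0r => /eqP.
  by rewrite GRing.oner_eq0.
by rewrite def_d; congr pair; lia.
Qed.

(** * Base at least 3 with digits 0, 1 *)

Lemma nb_reprs01_rec b n r : 3 <= b -> r < b ->
  nb_reprs b [:: 0; 1] (n * b + r) = if r <= 1 then nb_reprs b [:: 0; 1] n else 0.
Proof.
move=> b_ge3 lt_rb; rewrite nb_reprs_rec //; last lia.
have cond a : a <= 1 -> (a <= n * b + r) && (b %| n * b + r - a) = (a == r).
  move=> a_le1; apply/andP/eqP => [[le_a /dvdnP[q def_q]]|->].
    have [lt_qn|lt_nq|eq_qn] := ltngtP q n; nia.
  by rewrite leq_addl addnK dvdn_mull.
rewrite !big_cons big_nil !cond // addn0.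
case: r lt_rb {cond} => [|[|r]] lt_rb //=; rewrite ?addn0 ?subn0 ?addnK mulnK //; lia.
Qed.

Lemma nb_reprs01_pow b k : 3 <= b -> nb_reprs b [:: 0; 1] (b ^ k) = 1.
Proof.
move=> b_ge3; elim: k => [|k IHk].
  by have := @nb_reprs01_rec b 0 1 b_ge3 ltac:(lia); rewrite mul0n nb_reprs0 //; lia.
by rewrite expnSr -[_ * b]addn0 nb_reprs01_rec //; lia.
Qed.

(** The leading base-[b] digit is 2, and removing the last digit keeps it until only 2 is left. *)
Lemma nb_reprs01_gap b k j : 3 <= b -> j < b ^ k ->
  nb_reprs b [:: 0; 1] (2 * b ^ k + j) = 0.
Proof.
move=> b_ge3; elim: k j => [|k IHk] j lt_j.
  have -> : j = 0 by lia.
  by have := @nb_reprs01_rec b 0 2 b_ge3 ltac:(lia).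
rewrite (divn_eq j b) addnA expnSr mulnA -mulnDl nb_reprs01_rec ?ltn_mod //; last lia.
by rewrite IHk ?if_same // ltn_divLR -?expnSr //; lia.
Qed.

Lemma nb_reprs01_not_periodic b d : 3 <= b -> 2 <= d ->
  ~ eventually_periodic (fun n => nb_reprs b [:: 0; 1] n %% d).
Proof.
move=> b_ge3 d_ge2 [T T_gt0 [N shiftT]].
(* Then b^k exceeds both [N] and [T]: the gap starts after [N] and is longer than [T], so its zeros
   propagate forever, even to b^(k+1). *)
set g := nb_reprs b _ in shiftT *; pose k := N + T.
have lt_k : k < b ^ k by apply: ltn_expl; lia.
have zero j : g (2 * b ^ k + j) %% d = 0.
  elim/ltn_ind: j => j IHj; have [lt_jT|le_Tj] := ltnP j T.
    by rewrite /g nb_reprs01_gap ?mod0n //; lia.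
  by rewrite -(subnK le_Tj) addnA shiftT ?IHj //; lia.
have := zero (b ^ k.+1 - 2 * b ^ k); rewrite subnKC.
  by rewrite /g nb_reprs01_pow // modn_small.
by rewrite expnS leq_mul2r; lia.
Qed.

Theorem theorem1p3 :
  (let f := nb_reprs 2 [:: 0; 1; 2] in
   forall d T : nat, 2 <= d ->
     eventually_periodic_with_period (fun n => f n %% d) T ->
     (d, T) = (2, 3)) /\
  (forall b d : nat, 3 <= b -> 2 <= d ->
     let g := nb_reprs b [:: 0; 1] in
     ~ eventually_periodic (fun n => g n %% d)).
Proof.
by split; [exact: period_nb_reprs012 | exact: nb_reprs01_not_periodic].
Qed.
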